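(* Let $(X_n)_{n\in\mathbb{N}}$ be a Markov chain on a finite state space $S$ with transition probability matrix $P$ and associated graph $G=(S,E)$. A point $i\in S$ is a transient point of the Markov chain if and only if $i\in S\setminus\bigcup C$, where the union is over all maximal communicating classes $C$ of the graph $G$.
   Context: Markov chains are time-homogeneous; $p(i,j)$ are the entries of $P$. The associated graph $G=(S,E)$ has $(i,j)\in E$ iff $p(i,j)>0$. Write $i\sim j$ if there are directed paths of length $\ge 1$ in $G$ from $i$ to $j$ and from $j$ to $i$; let $V_c=\{i\in S:i\sim j \text{ for some } j\in S\}$; the communicating classes of $G$ are the sets $[i]=\{j\in S: j\sim i\}$, $i\in V_c$. They are partially ordered by $C_\mu\preceq C_\nu$ iff there is a path in $G$ from some vertex of $C_\mu$ to some vertex of $C_\nu$; ''maximal'' means maximal with respect to $\preceq$. With $\tau_i=\inf\{n\ge1: X_n=i\}$, a state $i$ is recurrent if $\mathbb{P}\{\tau_i<\infty\mid X_0=i\}=1$, and transient otherwise. *)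

(* Defs.v *)
From HB Require Import structures.
From mathcomp Require Import all_boot all_order all_algebra.
From mathcomp Require Import all_classical all_reals all_analysis.

Set Implicit Arguments.
Unset Strict Implicit.
Unset Printing Implicit Defensive.

Import Order.TTheory GRing.Theory Num.Theory.
Import numFieldNormedType.Exports.

Local Open Scope classical_set_scope.
Local Open Scope ring_scope.

Definition stochastic (R : realType) (S : finType) (P : S -> S -> R) : Prop :=
  (forall i j, 0 <= P i j) /\ (forall i, \sum_(j : S) P i j = 1).

(* Only meaningful when B has positive probability. *)
Definition cond_prob (R : realType) (d : measure_display)
    (Omega : measurableType d) (Q : probability Omega R) (A B : set Omega) : R :=
  fine (Q (A `&` B)) / fine (Q B).

Definition history (Omega : Type) (S : finType) (X : nat -> Omega -> S)
    (x : nat -> S) (n : nat) : set Omega :=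
  [set w | forall k, (k <= n)%N -> X k w = x k].

(* Time-homogeneous Markov property under the law Q, with no condition on the
   initial distribution; S carries the discrete sigma-algebra, so measurability
   of X n is measurability of its fibres. *)
Definition markov_chain (R : realType) (d : measure_display)
    (Omega : measurableType d) (S : finType)
    (Q : probability Omega R) (X : nat -> Omega -> S) (P : S -> S -> R) : Prop :=
  (forall n j, measurable (X n @^-1` [set j])) /\
  (forall (n : nat) (x : nat -> S),
     (0 < Q (history X x n))%E ->
     cond_prob Q (X n.+1 @^-1` [set x n.+1]) (history X x n)
       = P (x n) (x n.+1)).

(* Pr i is the law of the chain started at i, i.e. the meaning of
   P{ . | X_0 = i}; having one such law for every i gives a sense to this
   conditioning at every state. *)
Definition markov_family (R : realType) (d : measure_display)
    (Omega : measurableType d) (S : finType)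
    (Pr : S -> probability Omega R) (X : nat -> Omega -> S)
    (P : S -> S -> R) : Prop :=
  forall i, markov_chain (Pr i) X P /\ (Pr i (X 0%N @^-1` [set i]) = 1)%E.

(* The infimum is taken in \bar R, so that it is +oo on an empty set. *)
Definition return_time (R : realType) (Omega : Type) (S : finType)
    (X : nat -> Omega -> S) (i : S) (w : Omega) : \bar R :=
  ereal_inf [set (n%:R)%:E | n in [set n | (1 <= n)%N /\ X n w = i]].

Definition recurrent (R : realType) (d : measure_display)
    (Omega : measurableType d) (S : finType)
    (Pr : S -> probability Omega R) (X : nat -> Omega -> S) (i : S) : Prop :=
  (Pr i [set w | return_time R X i w < +oo] = 1)%E.

Definition transient (R : realType) (d : measure_display)
    (Omega : measurableType d) (S : finType)
    (Pr : S -> probability Omega R) (X : nat -> Omega -> S) (i : S) : Prop :=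
  ~ recurrent Pr X i.

Definition chain_graph (R : realType) (S : finType) (P : S -> S -> R) : rel S :=
  fun i j => 0 < P i j.

(* The sequence p lists the vertices after i; its size is the path length. *)
Definition dpath (S : finType) (e : rel S) (i : S) (p : seq S) (j : S) : Prop :=
  path e i p /\ last i p = j.

Definition leads_to (S : finType) (e : rel S) (i j : S) : Prop :=
  exists2 p : seq S, (1 <= size p)%N & dpath e i p j.

Definition communicate (S : finType) (e : rel S) (i j : S) : Prop :=
  leads_to e i j /\ leads_to e j i.

Definition Vc (S : finType) (e : rel S) : set S :=
  [set i | exists j, communicate e i j].

Definition comm_class (S : finType) (e : rel S) (i : S) : set S :=
  [set j | communicate e j i].

Definition comm_classes (S : finType) (e : rel S) : set (set S) :=
  [set comm_class e i | i in Vc e].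

Definition class_le (S : finType) (e : rel S) (C D : set S) : Prop :=
  exists i j p, [/\ C i, D j & dpath e i p j].

Definition maximal_classes (S : finType) (e : rel S) : set (set S) :=
  [set C | comm_classes e C /\
     forall D, comm_classes e D -> class_le e C D -> D = C].

(* Main.v *)
(** A state [i] lies in a maximal class exactly when every state reachable from
    [i] leads back to [i]. Let [h j] be the probability that the chain started
    at [j] never visits [i] at a positive time; it is the limit of the
    probabilities of missing [i] at times 1, ..., n, which satisfy a one-step
    recursion, so [h] is harmonic off [i]. If some [j] reachable from [i] does
    not lead back, then a simple path from [i] to [j] has positive probability
    and [h i > 0]. Otherwise the maximum principle on the states reachable from
    [i] gives [h i = 0]. *)

Require Import Defs.
From HB Require Import structures.
From mathcomp Require Import all_boot all_order all_algebra.
From mathcomp Require Import all_classical all_reals all_analysis.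

Import Order.TTheory GRing.Theory Num.Theory.
Import numFieldNormedType.Exports.

Local Open Scope classical_set_scope.
Local Open Scope ring_scope.

Set Implicit Arguments.
Unset Strict Implicit.
Unset Printing Implicit Defensive.

(** * Graph theory: essential states and maximal communicating classes *)

Definition essential (S : finType) (e : rel S) (i : S) : Prop :=
  forall j, connect e i j -> connect e j i.

Lemma leads_to_connect (S : finType) (e : rel S) (i j : S) :
  leads_to e i j -> connect e i j.
Proof. by move=> [p _ [ep <-]]; apply/connectP; exists p. Qed.

Lemma leads_to_trans (S : finType) (e : rel S) (i j k : S) :
  leads_to e i j -> leads_to e j k -> leads_to e i k.
Proof.
move=> [p p0 [ep lp]] [q _ [eq lq]]; exists (p ++ q).
  by rewrite size_cat addn_gt0 p0.
by split; rewrite ?cat_path ?last_cat lp // ep.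
Qed.

Lemma leads_to_edge (S : finType) (e : rel S) (i j k : S) :
  e i j -> connect e j k -> leads_to e i k.
Proof.
move=> eij /connectP[p ep ->]; exists (j :: p) => //.
by split=> //=; rewrite eij.
Qed.

(** Among the states reachable from [i], one with the fewest reachable states works: anything it
    leads to reaches a subset of the same set, hence by minimality all of it. *)
Lemma essential_reachable (S : finType) (e : rel S) (i : S) :
  exists2 k, connect e i k & essential e k.
Proof.
have [k cik kmin] := @arg_minnP S i (connect e i)
  (fun k => #|connect e k|) (connect0 e i).
exists k => // j ckj; have cij := connect_trans cik ckj.
have sub : connect e j \subset connect e k.
  by apply/fintype.subsetP => l; exact: connect_trans.
have : connect e k \subset connect e j.
  by rewrite -(geq_leqif (subset_leqif_card sub)) kmin.
by move/fintype.subsetP => /(_ k); apply; exact: connect0.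
Qed.

(** [connect] admits the empty path while [communicate] does not; taking an outgoing edge first
    makes both paths nonempty. *)
Lemma essential_communicate (S : finType) (e : rel S) (i j : S) :
  (forall i, exists j, e i j) -> essential e i ->
  connect e i j -> communicate e i j.
Proof.
move=> edge ess cij; have [k eik] := edge i; have [l ejl] := edge j.
split; first exact: leads_to_edge eik (connect_trans (ess _ (connect1 eik)) cij).
apply: (leads_to_edge ejl); apply: ess.
exact: connect_trans cij (connect1 ejl).
Qed.

(* Without outgoing edges everywhere this fails: a sink is essential, but it
   lies in no communicating class. *)
Lemma in_maximal_classesP (S : finType) (e : rel S) (i : S) :
  (forall i, exists j, e i j) ->
  (\bigcup_(C in maximal_classes e) C) i <-> essential e i.
Proof.
move=> edge; split=> [[C [[a _ <-] maxC] [lia lai]] j cij|ess].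
  (* The class of an essential [k] beyond [j] lies above that of [a], so maximality identifies the
     two and [k] leads back to [i]. *)
  have [k cjk essk] := essential_reachable e j.
  have kk : communicate e k k by exact: essential_communicate.
  have cik := connect_trans cij cjk.
  have [p ep kE] := connectP cik.
  have eqC : comm_class e k = comm_class e a.
    apply: maxC; first by exists k => //; exists k.
    by exists i, k, p; split.
  have [+ _] : comm_class e a k by rewrite -eqC.
  move=> /leads_to_connect cka; apply: connect_trans cjk _.
  exact: connect_trans cka (leads_to_connect lai).
have ii : communicate e i i by exact: essential_communicate.
exists (comm_class e i) => //; split; first by exists i => //; exists i.
move=> _ [k _ <-] [x [y [p [[xi ix] [yk ky] [ep py]]]]].
have cxy : connect e x y by apply/connectP; exists p.
have ciy := connect_trans (leads_to_connect ix) cxy.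
have cik := connect_trans ciy (leads_to_connect yk).
have [iTk kTi] := essential_communicate edge ess cik.
apply/seteqP; split=> z [h1 h2]; split.
- exact: leads_to_trans h1 kTi.
- exact: leads_to_trans iTk h2.
- exact: leads_to_trans h1 iTk.
- exact: leads_to_trans kTi h2.
Qed.

(** * Avoidance probabilities and their limits *)

(* [avoid P i n j] is the probability that the chain started at [j] misses [i]
   at all of the times 1, ..., n. *)
Fixpoint avoid (R : realType) (S : finType) (P : S -> S -> R) (i : S) (n : nat)
    (j : S) : R :=
  if n is m.+1 then \sum_(k | k != i) P j k * avoid P i m k else 1.

Lemma stochastic_edge (R : realType) (S : finType) (P : S -> S -> R) (i : S) :
  stochastic P -> exists j, chain_graph P i j.
Proof.
move=> [P0 P1]; apply: contrapT => none; have := P1 i.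
rewrite big1 => [/esym/eqP|j _]; first by rewrite oner_eq0.
apply: le_anti; rewrite P0 andbT leNgt; apply/negP => Pij.
by apply: none; exists j.
Qed.

Lemma avoid_ge0 (R : realType) (S : finType) (P : S -> S -> R) (i : S) n j :
  stochastic P -> 0 <= avoid P i n j.
Proof.
move=> [P0 _]; elim: n j => [|n IH] j //=.
by apply: sumr_ge0 => k _; apply: mulr_ge0.
Qed.

Lemma avoid_unreachable (R : realType) (S : finType) (P : S -> S -> R)
    (i : S) n j :
  stochastic P -> ~~ connect (chain_graph P) j i -> avoid P i n j = 1.
Proof.
move=> [P0 P1]; elim: n j => [|n IH] j cji //=.
rewrite -(P1 j) (bigD1 (P := xpredT) i) //= [X in X + _](_ : P j i = 0).
  rewrite add0r; apply: eq_bigr => k _.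
  have [Pjk|] := ltP 0 (P j k); last first.
    by move=> ?; rewrite (_ : P j k = 0) ?mul0r //; apply: le_anti; rewrite P0 andbT.
  rewrite IH ?mulr1 //; apply: contra cji; apply: connect_trans.
  exact: connect1.
apply: le_anti; rewrite P0 andbT leNgt; apply: contra cji => Pji.
exact: connect1.
Qed.

(** The constant is the product of the transition probabilities along [p]: each unfolding of [avoid]
    keeps only the term of the next vertex. It does not depend on [n], so the bound survives the
    limit. *)
Lemma avoid_path (R : realType) (S : finType) (P : S -> S -> R) (i j : S) p :
  stochastic P -> path (chain_graph P) j p -> i \notin p ->
  ~~ connect (chain_graph P) (last j p) i ->
  exists2 c : R, 0 < c & forall n, c <= avoid P i (size p + n) j.
Proof.
move=> hP; elim: p j => [|k p IH] j /=.
  by move=> _ _ nc; exists 1 => // n; rewrite avoid_unreachable.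
move=> /andP[Pjk ep]; rewrite inE negb_or => /andP[ik ip] nc.
have [c c0 hc] := IH k ep ip nc; exists (P j k * c); first exact: mulr_gt0.
move=> n; rewrite (bigD1 k) 1?eq_sym //=.
rewrite -[leLHS]addr0; apply: lerD; first by rewrite ler_wpM2l // ltW.
by apply: sumr_ge0 => l _; rewrite mulr_ge0 ?avoid_ge0 //; case: hP.
Qed.

Lemma avoid_lim_gt0 (R : realType) (S : finType) (P : S -> S -> R) (i : S)
    (l : R) :
  stochastic P -> ~ essential (chain_graph P) i ->
  avoid P i n i @[n --> \oo] --> l -> 0 < l.
Proof.
move=> hP /existsNP[j /not_implyP[/connectP[q eq jE] /negP nji]] cvl.
have [p [ep lp ip]] : exists p, [/\ path (chain_graph P) i p,
    last i p = j & i \notin p].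
  (* Shortening makes the vertices of [i :: p] distinct, so [p] never returns to [i]. *)
  by move: jE; case/shortenP: eq => p ep /andP[ip _] _ ->; exists p.
have [|c c0 hc] := avoid_path hP ep ip; first by rewrite lp.
apply: (lt_le_trans c0); apply: (cvgr_to_ge cvl).
near=> n; rewrite -(@subnKC (size p) n) //; near: n.
exact: nbhs_infty_ge.
Unshelve. all: by end_near. Qed.

(* Maximum principle: the limit is harmonic off [i], so on an essential class
   its maximum spreads along edges, and an edge into [i] forces it to be 0. *)
Lemma avoid_lim_eq0 (R : realType) (S : finType) (P : S -> S -> R) (i : S)
    (h : S -> R) :
  stochastic P -> essential (chain_graph P) i ->
  (forall j, avoid P i n j @[n --> \oo] --> h j) -> h i = 0.
Proof.
move=> hP ess cvh; have [P0 P1] := hP; set e := chain_graph P.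
have h0 j : 0 <= h j.
  apply: (cvgr_to_ge (cvh j)); by near=> n; exact: avoid_ge0.
have harm j : h j = \sum_(k | k != i) P j k * h k.
  have c1 : avoid P i n.+1 j @[n --> \oo] --> h j.
    by have := cvh j; rewrite -(@cvg_shiftS _ (fun n => avoid P i n j)).
  apply: (cvg_unique _ c1) => //=.
  apply: cvg_big => [|k _]; first exact: add_continuous.
  by apply: cvgM; [exact: cvg_cst | exact: cvh].
have [m cim hm] := @arg_maxP _ _ _ i (connect e i) h (connect0 e i).
have spread j k : connect e i j -> h j = h m -> e j k ->
    h m != 0 -> k != i /\ h k = h m.
  move=> cij hj ejk hm0.
  (* Setting the value at [i] to 0 turns the sum over [k != i] into a full average: [h m] is a mean
     of values [g l] that are at most [h m] wherever the weight is positive, so equality holds along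
     each edge. *)
  pose g k := if k == i then 0 else h k.
  have gle l : connect e i l -> g l <= h m.
    by move=> cil; rewrite /g; case: eqP => [_|_]; [exact: h0|exact: hm].
  have sum0 : \sum_l P j l * (h m - g l) = 0.
    under eq_bigr do rewrite mulrBr.
    rewrite sumrB -mulr_suml P1 mul1r -{1}hj harm big_mkcond /= -sumrB.
    by apply: big1 => l _; rewrite /g; case: eqP => _ /=; rewrite ?mulr0 subrr.
  have ge0 l : true -> 0 <= P j l * (h m - g l).
    move=> _; have [Pjl|Pjl] := ltP 0 (P j l).
      rewrite mulr_ge0 // subr_ge0 gle //.
      exact: connect_trans cij (connect1 Pjl).
    by rewrite (_ : P j l = 0) ?mul0r //; apply: le_anti; rewrite Pjl P0.
  have /eqP := psumr_eq0P ge0 sum0 (i := k) isT.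
  rewrite mulf_eq0 (gt_eqF ejk) subr_eq0 /g /=.
  by have [_|ki /eqP ->] := eqVneq k i; rewrite ?(negPf hm0).
have [hm0|hm0] := eqVneq (h m) 0.
  by apply: le_anti; rewrite h0 andbT -hm0; apply: hm; exact: connect0.
have visit p j : connect e i j -> h j = h m -> path e j p -> p != [::] ->
    last j p != i.
  elim: p j => [//|k p IH] j cij hj /= /andP[ejk ep] _.
  have [ki hk] := spread _ _ cij hj ejk hm0.
  case: p IH ep => [//|l p] IH ep; apply: IH => //.
  exact: connect_trans cij (connect1 ejk).
(* Since [m] may be [i] itself, a first edge is taken to get a nonempty path from [m] to [i]. *)
have [k emk] := stochastic_edge m hP.
have [p ep iE] := connectP (ess k (connect_trans cim (connect1 emk))).
have emp : path e m (k :: p) by apply/andP.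
by have := visit _ _ cim erefl emp isT; rewrite /= -iE eqxx.
Unshelve. all: by end_near. Qed.

(** * From the law of the chain to avoidance probabilities *)

Lemma return_time_lt_pinfty (R : realType) (Omega : Type) (S : finType)
    (X : nat -> Omega -> S) (i : S) :
  [set w | (return_time R X i w < +oo)%E] = ~` (\bigcap_n [set w | X n.+1 w <> i]).
Proof.
rewrite setC_bigcap; apply/seteqP; split=> w /=.
  move=> /ereal_inf_lt[_ [n [n1 Xn] <-] _].
  by exists n.-1 => //= /(_ _); rewrite prednK.
move=> [n _ /= /contrapT Xn]; apply: (@le_lt_trans _ _ (n.+1%:R)%:E).
  by apply: ereal_inf_lbound; exists n.+1.
exact: ltry.
Qed.

(** The window consists of the times [m + 1], ..., [m + n]; its start is a parameter so that an
    induction on [n] can move it. *)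
Definition misses (Omega : Type) (S : finType) (X : nat -> Omega -> S) (i : S)
    (m n : nat) : set Omega :=
  [set w | forall k, (k < n)%N -> X (m + k).+1 w <> i].

Section Measurability.
Context (R : realType) (d : measure_display) (Omega : measurableType d).
Context (S : finType) (Q : probability Omega R) (X : nat -> Omega -> S).
Context (P : S -> S -> R) (hX : markov_chain Q X P).

Lemma measurable_history x n : measurable (history X x n).
Proof.
rewrite (_ : history _ _ _ = \bigcap_(k < n.+1) (X k @^-1` [set x k])).
  by apply: bigcap_measurable => [|k _]; [exists 0%N | exact: hX.1].
by apply/seteqP; split=> w /= h k kn; exact: h.
Qed.

Lemma measurable_neq i n : measurable [set w | X n w <> i].
Proof.
rewrite (_ : [set w | X n w <> i] = ~` (X n @^-1` [set i])) //.
exact/measurableC/hX.1.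
Qed.

Lemma measurable_misses i m n : measurable (misses X i m n).
Proof.
rewrite (_ : misses _ _ _ _ =
    \bigcap_k (if (k < n)%N then [set w | X (m + k).+1 w <> i] else setT)).
  apply: bigcapT_measurable => k; case: ifP => _ //; exact: measurable_neq.
apply/seteqP; split=> w /= h k.
  by move=> _ /=; case: ifP => // kn; exact: h.
by move=> kn; have := h k I; rewrite kn.
Qed.

Lemma probability_history_step x n :
  (Q (history X x n.+1) = Q (history X x n) * (P (x n) (x n.+1))%:E)%E.
Proof.
have -> : history X x n.+1 = X n.+1 @^-1` [set x n.+1] `&` history X x n.
  apply/seteqP; split=> w /=.
    by move=> h; split=> [|k kn]; apply: h => //; exact: leqW.
  by move=> [h hk] k; rewrite leq_eqVlt => /predU1P[->//|]; exact: hk.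
have mH := measurable_history x n; have mX := hX.1 n.+1 (x n.+1).
(* The Markov property says nothing about a null history, but then both sides vanish. *)
have [Q0|] := eqVneq (Q (history X x n)) 0%E.
  rewrite Q0 mul0e; apply/eqP; rewrite -measure_le0 -Q0.
  exact: measureIr.
rewrite -measure_gt0 => Qgt0; rewrite -(hX.2 n x Qgt0) /cond_prob.
have fH := fin_num_measure Q _ mH.
have fI := fin_num_measure Q _ (measurableI _ _ mX mH).
rewrite -[LHS]fineK // -[X in (X * _)%E]fineK // -EFinM; congr EFin.
by rewrite mulrC divfK // gt_eqF // fine_gt0 // Qgt0 ltey_eq fH.
Qed.

(** Induction on [n]: splitting by the value at time [m + 1] lengthens the history by one step and
    reproduces the recursion of [avoid]. *)
Lemma probability_history_misses i n m x :
  (Q (history X x m `&` misses X i m n) =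
   Q (history X x m) * (avoid P i n (x m))%:E)%E.
Proof.
elim: n m x => [|n IH] m x.
  rewrite mule1; congr (Q _); apply/seteqP; split=> w; first by case.
  by move=> hw; split.
pose upd k l := if l == m.+1 then k else x l.
have updl k l : (l <= m)%N -> upd k l = x l.
  by move=> lm; rewrite /upd ltn_eqF.
have updm k : upd k m.+1 = k by rewrite /upd eqxx.
pose r := [seq k <- index_enum S | k != i].
pose F k := history X (upd k) m.+1 `&` misses X i m.+1 n.
have -> : history X x m `&` misses X i m n.+1 = \bigcup_(k in [set` r]) F k.
  apply/seteqP; split=> w /=.
    move=> [hw miss]; exists (X m.+1 w) => /=.
      rewrite mem_filter mem_index_enum andbT; apply/eqP.
      by have := miss 0%N isT; rewrite addn0.
    split=> [l|l ln].
      rewrite leq_eqVlt => /predU1P[->|]; first by rewrite updm.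
      by rewrite ltnS => lm; rewrite updl // hw.
    by have := miss l.+1 ln; rewrite addnS.
  move=> [k]; rewrite /= mem_filter => /andP[/eqP ki _] [hw miss]; split.
    by move=> l lm; rewrite hw ?leqW // updl.
  move=> [_|l]; first by rewrite addn0 hw // updm.
  by rewrite ltnS => /miss; rewrite addnS.
have mF k : measurable (F k).
  by apply: measurableI; [exact: measurable_history|exact: measurable_misses].
rewrite measure_fin_bigcup //; last first.
  by apply/trivIsetP => k l _ _ /eqP kl; apply/seteqP; split=> // w
    [[/(_ m.+1 (leqnn _)) + _] [/(_ m.+1 (leqnn _)) + _]];
    rewrite !updm => -> /kl.
rewrite -fsbig_seq ?filter_uniq ?index_enum_uniq // big_filter.
rewrite -[Q (history X x m)]fineK ?fin_num_measure //; last first.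
  exact: measurable_history.
rewrite -EFinM mulr_sumr -sumEFin; apply: eq_bigr => k _.
rewrite [LHS](IH m.+1 (upd k)) probability_history_step updm updl // EFinM EFinM muleA.
rewrite fineK ?fin_num_measure //; last exact: measurable_history.
suff -> : history X (upd k) m = history X x m by [].
by apply/seteqP; split=> w hw l lm; have := hw l lm; rewrite updl.
Qed.

Lemma probability_misses i j n : (Q (X 0%N @^-1` [set j]) = 1)%E ->
  Q (misses X i 0 n) = (avoid P i n j)%:E.
Proof.
set H := _ @^-1` _ => QH.
have HE : history X (fun=> j) 0 = H.
  apply/seteqP; split=> w /= Xj; first exact: Xj.
  by move=> k; rewrite leqn0 => /eqP ->.
have mH : measurable H by exact: hX.1.
have mM := measurable_misses i 0 n.
have := probability_history_misses i n 0 (fun=> j).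
(* The part of the event outside [H] is null because [H] has probability 1. *)
rewrite HE QH mul1e => <-; rewrite setIC [LHS](measureDI _ mM mH).
rewrite [X in (X + _)%E](_ : _ = 0%E) ?add0e //.
apply/eqP; rewrite -measure_le0 -(subee (x := 1%E)) // -{2}QH.
rewrite -probability_setC // setDE; apply: measureIr => //.
exact: measurableC.
Qed.

(** Continuity of the measure from above, along the decreasing events [misses X i 0 n]. *)
Lemma cvg_avoid i j : (Q (X 0%N @^-1` [set j]) = 1)%E ->
  avoid P i n j @[n --> \oo] -->
    fine (Q (\bigcap_n [set w | X n.+1 w <> i])).
Proof.
move=> Qj; have mI : measurable (\bigcap_n [set w | X n.+1 w <> i]).
  by apply: bigcapT_measurable => n; exact: measurable_neq.
have IE : \bigcap_n misses X i 0 n = \bigcap_n [set w | X n.+1 w <> i].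
  apply/seteqP; split=> w h n _ /=; first exact: (h n.+1 I n (ltnSn n)).
  by move=> k _; exact: (h k I).
have -> : avoid P i ^~ j = fine \o (Q \o misses X i 0).
  by apply/funext => n /=; rewrite (probability_misses i n Qj).
apply: fine_cvg; rewrite fineK ?fin_num_measure // -IE.
apply: nonincreasing_cvg_mu => [||| m n mn].
- exact: le_lt_trans (probability_le1 _ (measurable_misses _ _ _)) (ltry 1).
- by move=> n; exact: measurable_misses.
- by rewrite IE.
- by apply/subsetPset => w h k km; apply: h; exact: leq_trans mn.
Qed.

End Measurability.

Lemma recurrentP (R : realType) (S : finType) (P : S -> S -> R)
    (d : measure_display) (Omega : measurableType d)
    (Pr : S -> probability Omega R) (X : nat -> Omega -> S) (i : S) :
  markov_family Pr X P ->
  recurrent Pr X i <-> fine (Pr i (\bigcap_n [set w | X n.+1 w <> i])) = 0.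
Proof.
move=> hX; have mI : measurable (\bigcap_n [set w | X n.+1 w <> i]).
  by apply: bigcapT_measurable => n; exact: measurable_neq (hX i).1 _ _.
rewrite /recurrent return_time_lt_pinfty probability_setC //.
rewrite -[X in (1 - X)%E]fineK ?fin_num_measure // -EFinB.
split=> [[]/eqP|->]; last by rewrite subr0.
by rewrite subr_eq addrC -subr_eq subrr eq_sym => /eqP.
Qed.

Theorem fact11 (R : realType) (S : finType) (P : S -> S -> R)
    (d : measure_display) (Omega : measurableType d)
    (Pr : S -> probability Omega R) (X : nat -> Omega -> S)
    (hP : stochastic P) (hX : markov_family Pr X P) (i : S) :
  transient Pr X i <->
  ([set: S] `\` \bigcup_(C in maximal_classes (chain_graph P)) C) i.
Proof.
have edge j := stochastic_edge j hP.
have cvh j := cvg_avoid (i := i) (hX j).1 (hX j).2.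
suff recE : recurrent Pr X i <-> essential (chain_graph P) i.
  split=> [ti|[_ ni]]; first by split=> // /(in_maximal_classesP i edge)/recE.
  by move=> /recE/(in_maximal_classesP i edge).
(* Recurrence now says that the limit of [avoid P i n i] is 0. *)
rewrite (recurrentP i hX); split; last by move=> ess; exact: avoid_lim_eq0 cvh.
move=> h0; apply: contrapT => ness.
by have := avoid_lim_gt0 hP ness (cvh i); rewrite h0 ltxx.
Qed.
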